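(* For all integers $n\ge2$ and $0\le k\le n-1$, the polytope $\mathrm{SSB}(n,k)$ satisfies the weak, strong and star Ewald conditions.
   Context: For $n\ge2$ and $0\le k\le n-1$, $\mathrm{SSB}(n,k)\subset\mathbb{R}^n$ is the polytope defined by the inequalities $x_i\ge-1$ for $i=1,\dots,n$; $x_1\le1$; and $kx_1+x_2+\dots+x_n\le1$. For a polytope $P\subset\mathbb{R}^n$ of dimension $n$ with the origin in its interior, $\mathcal{E}(P):=\mathbb{Z}^n\cap P\cap(-P)$. For a face $f$ of $P$, $\operatorname{Star}(f)$ is the union of all facets containing $f$, $\operatorname{star}(f)$ the union of all codimension-two faces of $P$ containing $f$, and $\operatorname{Star}^*(f)=\operatorname{Star}(f)\setminus\operatorname{star}(f)$. Weak Ewald condition: $\mathcal{E}(P)$ contains a $\mathbb{Z}$-basis of $\mathbb{Z}^n$. Strong Ewald condition: for each facet $F$ of $P$ the set $\mathcal{E}(P)\cap F$ contains a $\mathbb{Z}$-basis of $\mathbb{Z}^n$. Star Ewald condition: for every nonempty proper face $f$ of $P$ there exists $\lambda\in\mathcal{E}(P)$ with $\lambda\in\operatorname{Star}^*(f)$ and $-\lambda\notin\operatorname{Star}(f)$. *)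

(* Defs.v *)
From mathcomp Require Import all_boot all_order all_algebra.
From mathcomp Require Import boolp classical_sets reals.

Set Implicit Arguments.
Unset Strict Implicit.
Unset Printing Implicit Defensive.

Import Order.TTheory GRing.Theory Num.Theory.
Local Open Scope ring_scope.
Local Open Scope classical_set_scope.

(* Points of R^n are row vectors; the coordinates x_1, ..., x_n are          *)
(* x 0 i for i : 'I_n of value 0, ..., n - 1.                                *)

Definition dotv (R : realFieldType) (n : nat) (u x : 'rV[R]_n) : R :=
  \sum_(i < n) u 0 i * x 0 i.

(* The affine hull of S is x0 + U with \dim U = d; in particular S is        *)
(* nonempty.                                                                 *)
Definition has_affdim (R : realFieldType) (n : nat) (S : set 'rV[R]_n)
    (d : nat) : Prop :=
  exists (x0 : 'rV[R]_n) (U : {vspace 'rV[R]_n}),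
    [/\ S x0,
        (forall x, S x -> x - x0 \in U),
        (forall V : {vspace 'rV[R]_n},
           (forall x, S x -> x - x0 \in V) -> (U <= V)%VS)
      & \dim U = d].

(* The trivial inequalities (u = 0) give the improper faces set0 and P.      *)
Definition face (R : realFieldType) (n : nat) (P f : set 'rV[R]_n) : Prop :=
  exists (u : 'rV[R]_n) (c : R),
    (forall x, P x -> dotv u x <= c) /\ f = P `&` [set x | dotv u x = c].

(* P is assumed to have dimension n.                                         *)
Definition face_codim (R : realFieldType) (n : nat) (P : set 'rV[R]_n)
    (r : nat) (f : set 'rV[R]_n) : Prop :=
  face P f /\ exists2 d, has_affdim f d & (d + r)%N = n.

Definition facet (R : realFieldType) (n : nat) (P F : set 'rV[R]_n) : Prop :=
  face_codim P 1 F.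

Definition Star (R : realFieldType) (n : nat) (P f : set 'rV[R]_n)
    : set 'rV[R]_n :=
  \bigcup_(F in [set F | facet P F /\ f `<=` F]) F.

Definition star (R : realFieldType) (n : nat) (P f : set 'rV[R]_n)
    : set 'rV[R]_n :=
  \bigcup_(G in [set G | face_codim P 2 G /\ f `<=` G]) G.

Definition Star_star (R : realFieldType) (n : nat) (P f : set 'rV[R]_n)
    : set 'rV[R]_n :=
  Star P f `\` star P f.

(* Z^n inside R^n *)
Definition Zlattice (R : realFieldType) (n : nat) : set 'rV[R]_n :=
  range (fun z : 'rV[int]_n => map_mx intr z).
Arguments Zlattice : clear implicits.

Definition is_Zbasis (R : realFieldType) (n : nat) (b : 'I_n -> 'rV[R]_n)
    : Prop :=
  (forall i, Zlattice R n (b i)) /\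
  (forall z, Zlattice R n z ->
     exists! c : 'rV[int]_n, z = \sum_(i < n) b i *~ c 0 i).

Definition contains_Zbasis (R : realFieldType) (n : nat) (S : set 'rV[R]_n)
    : Prop :=
  exists b : 'I_n -> 'rV[R]_n, is_Zbasis b /\ (forall i, S (b i)).

Definition Ewald_points (R : realFieldType) (n : nat) (P : set 'rV[R]_n)
    : set 'rV[R]_n :=
  Zlattice R n `&` P `&` [set - x | x in P].

Definition weak_Ewald (R : realFieldType) (n : nat) (P : set 'rV[R]_n)
    : Prop :=
  contains_Zbasis (Ewald_points P).

Definition strong_Ewald (R : realFieldType) (n : nat) (P : set 'rV[R]_n)
    : Prop :=
  forall F, facet P F -> contains_Zbasis (Ewald_points P `&` F).

Definition star_Ewald (R : realFieldType) (n : nat) (P : set 'rV[R]_n)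
    : Prop :=
  forall f, face P f -> f !=set0 -> f <> P ->
    exists l, [/\ Ewald_points P l, Star_star P f l & ~ Star P f (- l)].

Definition SSB (R : realFieldType) (n k : nat) : set 'rV[R]_n :=
  [set x : 'rV[R]_n |
    [/\ forall i : 'I_n, -1 <= x 0 i,
        forall i : 'I_n, i = 0%N :> nat -> x 0 i <= 1
      & \sum_(i < n | i == 0%N :> nat) k%:R * x 0 i
        + \sum_(i < n | i != 0%N :> nat) x 0 i <= 1]].
Arguments SSB : clear implicits.

(* Main.v *)
From HB Require Import structures.
Require Import Defs.
From mathcomp Require Import all_boot all_order all_algebra.
From mathcomp Require Import boolp classical_sets reals.
From mathcomp Require Import lra.

(** Write [k x_0 + x_1 + ... + x_m] for the form of the slanted facet, with
    [m + 1] coordinates numbered from [0].  The proof has a polyhedral part and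
    an arithmetic part.

    Polyhedral part.  Let [P] be cut out by finitely many inequalities
    [a_h . x <= 1].  A nonempty face is determined by the inequalities that are
    tight on all of it ([face_recover]): it has a point at which no further
    inequality is tight, and from such a point one can move a little away from
    any point of [P] satisfying the same equations, so the functional
    supporting the face is constant along that segment.  Suppose moreover that
    the Ewald points tight for each [a_h] contain a Z-basis.  Then each
    [P /\ {a_h . x = 1}] contains [n] linearly independent points, hence has
    dimension [n - 1]; so these sets are exactly the facets
    ([contact_facet], [facetE]), and a face of codimension two lies in two of
    them ([codim2_tight]).  This gives the weak and the strong condition
    at once, and turns the star condition into a combinatorial one
    ([star_Ewald_tight]): for the set [J] of inequalities tight on the face,
    find an Ewald point tight for exactly one member of [J] and whose opposite
    is tight for none.

    Arithmetic part.  The integer points used are [e_i], [e_i - e_j] for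
    [i, j >= 1], and translates by [t e_i] of the point
    [w = e_0 - (e_1 + ... + e_k)], on which the slanted form vanishes.
    Bases ([SSB_facet_basis]):
    - [x_0 = 1]: [w] and [w +- e_i]; [x_0 = -1]: their opposites;
    - the slanted facet: [w + e_i] for one [i >= 1], and all [e_j];
    - [x_i = -1]: [- e_i], [e_j - e_i], and whichever of [w], [w - e_i] has
      [i]-th coordinate [-1].

    Star condition ([SSB_star_point]): if [J] contains the slanted inequality
    then it misses some [x_j >= -1] with [j >= 1], since all of them together
    would force [k x_0 = m + 1] while [k x_0 <= k <= m]; the point [e_j] works.
    Otherwise, if [J] contains [x_i >= -1] with [i >= 1], the point [- e_i]
    works.  Otherwise [J] is one of the two opposite inequalities on [x_0], and
    [w] or [- w] works. *)

Set Implicit Arguments.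
Unset Strict Implicit.
Unset Printing Implicit Defensive.

Import Order.TTheory GRing.Theory Num.Theory.

(** * Linear forms, their kernels, and Z-bases *)

Section Dotv.
Local Open Scope ring_scope.
Variables (R : realFieldType) (n : nat).
Implicit Types u x y : 'rV[R]_n.

Lemma dotv_linear u : linear (dotv u : 'rV[R]_n -> R^o).
Proof.
move=> c x y; rewrite /dotv scaler_sumr -big_split /=.
by apply: eq_bigr => i _; rewrite !mxE mulrDr mulrCA.
Qed.

HB.instance Definition _ u :=
  GRing.isLinear.Build R 'rV[R]_n R^o _ (dotv u) (dotv_linear u).

Lemma dotvD u x y : dotv u (x + y) = dotv u x + dotv u y.
Proof. exact: raddfD. Qed.

Lemma dotvB u x y : dotv u (x - y) = dotv u x - dotv u y.
Proof. exact: raddfB. Qed.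

Lemma dotvZ u c x : dotv u (c *: x) = c * dotv u x.
Proof. exact: linearZ. Qed.

Lemma dotv0 u : dotv u 0 = 0.
Proof. exact: raddf0. Qed.

Definition hyper u : {vspace 'rV[R]_n} :=
  lker (linfun (dotv u : 'rV[R]_n -> R^o)).

Lemma mem_hyper u x : (x \in hyper u) = (dotv u x == 0).
Proof. by rewrite memv_ker lfunE. Qed.

Lemma dim_hyper u x : dotv u x != 0 -> (\dim (hyper u) + 1)%N = n.
Proof.
move=> ux0; pose f := linfun (dotv u : 'rV[R]_n -> R^o).
have dimf : \dim (limg f) = 1%N.
  apply/eqP; rewrite eqn_leq; apply/andP; split.
    by rewrite (leq_trans (dimvS (subvf _))) // dimvf.
  rewrite lt0n dimv_eq0; apply: contra ux0 => /eqP f0.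
  have := memv_img f (memvf x); rewrite f0 memv0.
  by rewrite lfunE.
have := limg_ker_dim f fullv; rewrite capfv dimf dimvf => ->.
by rewrite /dim /= mul1n.
Qed.

Lemma Zbasis_coord (b : 'I_n -> 'rV[R]_n) (y : 'rV[R]_n) : is_Zbasis b ->
  exists c : 'I_n -> R, y = \sum_i c i *: b i.
Proof.
move=> [_ bgen].
have /choice[C CE] : forall j : 'I_n, exists c : 'rV[int]_n,
    delta_mx 0 j = \sum_i b i *~ c 0 i :> 'rV[R]_n.
  move=> j; have [|c [cE _]] := bgen (delta_mx 0 j); last by exists c.
  by exists (delta_mx 0 j) => //; rewrite map_delta_mx.
exists (fun i => \sum_j y 0 j * (C j 0 i)%:~R).
rewrite {1}(row_sum_delta y).
under eq_bigr => j _ do rewrite CE scaler_sumr.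
rewrite exchange_big; apply: eq_bigr => i _ /=; rewrite scaler_suml.
by apply: eq_bigr => j _; rewrite -scaler_int scalerA.
Qed.

(** A Z-basis on the affine hyperplane [u . x = 1] affinely spans it: in
    [y = \sum_i c_i b_i] with [u . y = 0] the coefficients sum to [0], so each
    [b_i] may be replaced by [b_i - x0], for any [x0]. *)
Lemma hyper_sub_Zbasis u (b : 'I_n -> 'rV[R]_n) x0 (V : {vspace 'rV[R]_n}) :
  is_Zbasis b -> (forall i, dotv u (b i) = 1) -> (forall i, b i - x0 \in V) ->
  (hyper u <= V)%VS.
Proof.
move=> bB ub bV; apply/subvP => y; rewrite mem_hyper.
have [c ->] := Zbasis_coord y bB.
rewrite raddf_sum /=; under eq_bigr => i _ do rewrite dotvZ ub mulr1.
move=> /eqP c0.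
suff -> : \sum_i c i *: b i = \sum_i c i *: (b i - x0).
  by apply: rpred_sum => i _; apply: rpredZ.
under [RHS]eq_bigr => i _ do rewrite scalerBr.
by rewrite sumrB -scaler_suml c0 scale0r subr0.
Qed.

End Dotv.

(** * Faces of a polyhedron given by inequalities *)

Section Polyhedron.
Local Open Scope ring_scope.
Local Open Scope classical_set_scope.
Variables (R : realFieldType) (n : nat) (I : finType) (a : I -> 'rV[R]_n).
Variable P : set 'rV[R]_n.
Hypothesis PE : forall x, P x <-> forall h, dotv (a h) x <= 1.
Implicit Types (f G F : set 'rV[R]_n) (h : I).

Definition tight h : set 'rV[R]_n := [set x | dotv (a h) x = 1].

Lemma face_sub f : face P f -> f `<=` P.
Proof. by move=> [u [c [_ ->]]] x []. Qed.

(** Such a [y] is a relative interior point of [f].  It is built one inequality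
    at a time: passing to the midpoint with a point of [f] where [h] is strict
    makes [h] strict and keeps strict what already was. *)
Lemma face_relint f : face P f -> f !=set0 ->
  exists2 y, f y & forall h, tight h y -> f `<=` tight h.
Proof.
move=> ff [x0 fx0].
suff [y fy yP] : exists2 y, f y &
    forall h, h \in enum I -> tight h y -> f `<=` tight h.
  by exists y => // h; apply: yP; rewrite mem_enum.
elim: (enum I) => [|h s [y fy IH]]; first by exists x0.
have [fh|/existsNP[z /not_implyP[fz zh]]] := pselect (f `<=` tight h).
  exists y => // h'; rewrite inE => /orP[/eqP->//|]; exact: IH.
have Py := (PE y).1 (face_sub ff fy); have Pz := (PE z).1 (face_sub ff fz).
exists (2^-1 *: (y + z)).
  move: ff fy fz => [u [c [uP fE]]]; rewrite fE => -[_ /= uy] [_ /= uz].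
  split => /=; last by rewrite dotvZ dotvD uy uz; lra.
  apply/PE => h'; rewrite dotvZ dotvD.
  by move: (Py h') (Pz h') => ? ?; lra.
move=> h' h's; rewrite /tight /= dotvZ dotvD => yz1.
move: (Py h') (Pz h') => y1 z1.
have y1' : dotv (a h') y = 1 by lra.
have z1' : dotv (a h') z = 1 by lra.
move: h's; rewrite inE => /orP[/eqP hh|/IH]; last exact.
by case: zh; rewrite -hh.
Qed.

(** Used to stay in a polyhedron while moving in a direction along which each
    form [h] has slope [m h] and slack [r h]. *)
Lemma small_step (m r : I -> R) :
  (forall h, 0 < r h \/ r h = 0 /\ m h = 0) ->
  exists2 e, 0 < e & forall h, e * m h <= r h.
Proof.
move=> rP; have q0 h : 0 <= `|m h| / r h.
  by apply: divr_ge0 => //; case: (rP h) => [/ltW//|[->]].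
have s0 : 0 <= \sum_h `|m h| / r h by apply: sumr_ge0.
have S0 : 0 < 1 + \sum_h `|m h| / r h by rewrite ltr_wpDr.
(* When [r h = 0] the term [`|m h| / r h] is [0] by convention. *)
exists (1 + \sum_h `|m h| / r h)^-1; first by rewrite invr_gt0.
move=> h; case: (rP h) => [r0|[-> ->]]; last by rewrite mulr0.
rewrite mulrC ler_pdivrMr // mulrC -ler_pdivrMr //.
apply: le_trans (_ : `|m h| / r h <= _).
  by rewrite ler_pM2r ?invr_gt0 // ler_norm.
rewrite (bigD1 h) //= addrCA lerDl addr_ge0 //.
by apply: sumr_ge0.
Qed.

(** A face is the set of points of [P] where every inequality tight on the face
    is tight.  With [y] a relative interior point, [y + e (y - x)] is still in
    [P] for small [e > 0]; the supporting functional [u] is at most [c] there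
    and equals [c] at [y], hence is at least [c] at [x]. *)
Lemma face_recover f x : face P f -> f !=set0 -> P x ->
  (forall h, f `<=` tight h -> tight h x) -> f x.
Proof.
move=> ff f0 Px xt; have [y fy yP] := face_relint ff f0.
have Py := (PE y).1 (face_sub ff fy); have Px' := (PE x).1 Px.
have [|e e0 eP] := @small_step (fun h => dotv (a h) (y - x))
    (fun h => 1 - dotv (a h) y).
  move=> h; have [yh|yh] := eqVneq (dotv (a h) y) 1.
    by right; rewrite dotvB yh (xt h (yP h yh)) subrr.
  by left; rewrite subr_gt0 lt_neqAle yh Py.
have Pz : P (y + e *: (y - x)).
  apply/PE => h; rewrite dotvD dotvZ.
  by move: (eP h); rewrite lerBrDl.
move: ff fy => [u [c [uP fE]]]; rewrite fE => -[_ /= uy].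
split => //=; apply/eqP; rewrite eq_le uP //=.
move: (uP _ Pz); rewrite dotvD dotvZ dotvB uy gerDl pmulr_rle0 //.
by rewrite subr_le0.
Qed.


Definition contact h : set 'rV[R]_n := P `&` tight h.

Variable h0 : I.
Hypothesis n_gt0 : (0 < n)%N.
Hypothesis ZB : forall h, contains_Zbasis (Ewald_points P `&` tight h).

Lemma Zbasis_contact h : exists2 b : 'I_n -> 'rV[R]_n, is_Zbasis b &
  forall i, contact h (b i).
Proof.
by have [b [bB bh]] := ZB h; exists b => // i; have [[[_ ?] _] ?] := bh i.
Qed.

Lemma contact_dim h : (\dim (hyper (a h)) + 1)%N = n.
Proof.
have [b _ bh] := Zbasis_contact h.
by apply: (@dim_hyper _ _ _ (b (Ordinal n_gt0))); rewrite (bh _).2 oner_neq0.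
Qed.

Lemma contact_face h : face P (contact h).
Proof. by exists (a h), 1; split => // x /PE. Qed.

(** The Z-basis in [contact h] affinely spans a hyperplane. *)
Lemma contact_sub_dim F h d : has_affdim F d -> contact h `<=` F ->
  (n <= d + 1)%N.
Proof.
move=> [x0 [U [_ FU _ <-]]] hF; have [b bB bh] := Zbasis_contact h.
rewrite -[X in (X <= _)%N](contact_dim h) leq_add2r; apply: dimvS.
apply: (hyper_sub_Zbasis (x0 := x0) bB) => i; first exact: (bh i).2.
exact/FU/hF.
Qed.

Lemma contact_facet h : facet P (contact h).
Proof.
split; first exact: contact_face.
exists (\dim (hyper (a h))); last exact: contact_dim.
have [b bB bh] := Zbasis_contact h; pose x0 := b (Ordinal n_gt0).
exists x0, (hyper (a h)); split => //; first exact: bh.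
  by move=> x [_ /= xh]; rewrite mem_hyper dotvB xh (bh _).2 subrr.
move=> V hV; apply: (hyper_sub_Zbasis (x0 := x0) bB) => i.
  exact: (bh i).2.
exact: hV.
Qed.

Lemma proper_face_tight f : face P f -> f !=set0 -> f <> P ->
  exists h, f `<=` tight h.
Proof.
move=> ff f0 fP; apply: contrapT => /forallNP nf; apply: fP.
apply/seteqP; split=> [|x Px]; first exact: face_sub.
by apply: face_recover ff f0 Px _ => h /nf.
Qed.

Lemma has_affdim_neq0 F d : has_affdim F d -> F !=set0.
Proof. by move=> [x0 [U [Fx0 _ _ _]]]; exists x0. Qed.

(** If [F] is a facet inside [contact h], both span the same affine hyperplane,
    so the functional defining [F] is constant on [contact h].  It must be
    excluded that [F] is [P]: then [P], which contains the origin, would lie in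
    the hyperplane [a_h . x = 0]. *)
Lemma facetE F : facet P F -> exists h, F = contact h.
Proof.
move=> [ff [d Fd dn]].
have FP : F <> P.
  move=> FP; move: Fd; rewrite FP => -[x0 [U [_ PU _ dU]]].
  have P0 : P 0 by apply/PE => h; rewrite dotv0.
  have [b bB bh] := Zbasis_contact h0.
  have hU : (hyper (a h0) <= U)%VS.
    apply: (hyper_sub_Zbasis (x0 := x0) bB) => i; first exact: (bh i).2.
    by have [Pb _] := bh i; apply: PU.
  have UE : hyper (a h0) = U.
    apply/eqP; rewrite eqEdim hU dU -(leq_add2r 1) dn.
    by rewrite contact_dim leqnn.
  have [Pb hb] := bh (Ordinal n_gt0).
  have := rpredB (PU _ Pb) (PU _ P0).
  by rewrite -UE opprB addrA subrK subr0 mem_hyper hb oner_eq0.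
have F0 := has_affdim_neq0 Fd.
have [h Fh] := proper_face_tight ff F0 FP; exists h.
apply/seteqP; split=> [x Fx|x [Px hx]].
  by split; [exact: (face_sub ff)|exact: Fh].
move: Fd Fh ff => [x0 [U [Fx0 _ Umin dU]]] Fh [u [c [_ FE]]].
have UE : U = hyper (a h).
  apply/eqP; rewrite eqEdim -(leq_add2r 1) contact_dim dU dn leqnn andbT.
  by apply: Umin => y Fy; rewrite mem_hyper dotvB (Fh _ Fy) (Fh _ Fx0) subrr.
have : (U <= hyper u)%VS.
  apply: Umin => y; move: Fx0; rewrite FE => -[_ /= ux0] [_ /= uy].
  by rewrite mem_hyper dotvB uy ux0 subrr.
move=> /subvP /(_ (x - x0)); rewrite UE !mem_hyper !dotvB hx (Fh _ Fx0) subrr.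
move: Fx0; rewrite FE => -[_ /= ->] /(_ (eqxx _)); rewrite subr_eq0 => /eqP ?.
by split.
Qed.

(** By [face_recover], a face with at most one tight inequality contains a whole
    [contact h], and its dimension is too large. *)
Lemma codim2_tight G : face_codim P 2 G ->
  exists h1 h2, [/\ h1 != h2, G `<=` tight h1 & G `<=` tight h2].
Proof.
move=> [fG [d Gd dn]]; have G0 := has_affdim_neq0 Gd.
have noc h : ~ contact h `<=` G.
  by move=> /(contact_sub_dim Gd); rewrite -dn leq_add2l.
have [h1 Gh1] : exists h, G `<=` tight h.
  apply: contrapT => /forallNP nG.
  apply: (noc h0) => x [Px _].
  by apply: face_recover fG G0 Px _ => h /nG.
exists h1; apply: contrapT => /forallNP nh2.
apply: (noc h1) => x [Px xh1]; apply: face_recover fG G0 Px _ => h Gh.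
have [<-//|hh] := eqVneq h1 h.
by case: (nh2 h).
Qed.


Lemma contains_ZbasisS (S T : set 'rV[R]_n) :
  S `<=` T -> contains_Zbasis S -> contains_Zbasis T.
Proof. by move=> ST [b [bB bS]]; exists b; split => // i; apply: ST. Qed.

Lemma weak_Ewald_tight : weak_Ewald P.
Proof. by apply: contains_ZbasisS (ZB h0) => x []. Qed.

Lemma strong_Ewald_tight : strong_Ewald P.
Proof.
move=> F /facetE[h ->]; apply: contains_ZbasisS (ZB h) => x [Ex xh].
by split => //; split => //; case: Ex => -[].
Qed.

(** The combinatorial form of the star condition.  Every facet through a face
    is [contact h] for an [h] in the set [J] of its tight inequalities, and
    every codimension-two face through it is tight for two members of [J], so
    a point tight for just one member lies in [Star] and outside [star]. *)
Lemma star_Ewald_tight :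
  (forall (J : set I) x, J !=set0 -> P x -> (forall h, J h -> tight h x) ->
    exists l h, [/\ Ewald_points P l, J h, tight h l,
      forall h', J h' -> tight h' l -> h' = h &
      forall h', J h' -> ~ tight h' (- l)]) ->
  star_Ewald P.
Proof.
move=> Jl f ff f0 fP; have [x fx] := f0.
have [||l [h [El Jh hl luniq lN]]] :=
    Jl [set h | f `<=` tight h] x _ (face_sub ff fx).
- by have [h fh] := proper_face_tight ff f0 fP; exists h.
- by move=> h; apply.
exists l; split=> //.
  split.
    exists (contact h).
      split; first exact: contact_facet.
      by move=> y fy; split; [exact: (face_sub ff)|exact: Jh].
    by split => //; case: El => -[].
  move=> [G [/codim2_tight[h1 [h2 [h12 G1 G2]]] fG] Gl].
  have e1 : h1 = h by apply: luniq; [move=> y /fG /G1|exact: G1].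
  have e2 : h2 = h by apply: luniq; [move=> y /fG /G2|exact: G2].
  by rewrite e1 e2 eqxx in h12.
move=> [F [/facetE[h' ->] fF] [_ lh']].
by apply: (lN h') => // y /fF[].
Qed.

End Polyhedron.

(** * Z-bases as the rows of integer matrices *)

Section IntegerBases.
Local Open Scope ring_scope.
Local Open Scope classical_set_scope.
Variables (R : realFieldType) (n : nat).

(** The row lattice of [B].  Membership is enough to recognise a basis, since
    [n] vectors generating Z^n always form one. *)
Definition zspan (B : 'M[int]_n) : set 'rV[int]_n := range (mulmx^~ B).

Lemma zspanB B u v : zspan B u -> zspan B v -> zspan B (u - v).
Proof. by move=> [c _ <-] [d _ <-]; exists (c - d) => //; rewrite mulmxBl. Qed.

Lemma zspan0 B : zspan B 0.
Proof. by exists 0 => //; rewrite mul0mx. Qed.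

Lemma zspanN B u : zspan B u -> zspan B (- u).
Proof. by move=> uB; rewrite -sub0r; apply: zspanB => //; apply: zspan0. Qed.

Lemma zspanD B u v : zspan B u -> zspan B v -> zspan B (u + v).
Proof. by move=> uB vB; rewrite -[v]opprK; apply/zspanB/zspanN. Qed.

Lemma zspanZ B c u : zspan B u -> zspan B (c *: u).
Proof. by move=> [d _ <-]; exists (c *: d) => //; rewrite scalemxAl. Qed.

Lemma zspan_row B i : zspan B (row i B).
Proof. by exists (delta_mx 0 i) => //; rewrite rowE. Qed.

Lemma zspan_sum B (p : pred 'I_n) (F : 'I_n -> 'rV[int]_n) :
  (forall i, p i -> zspan B (F i)) -> zspan B (\sum_(i | p i) F i).
Proof.
by move=> FB; apply: big_ind => //; [apply: zspan0|move=> *; apply: zspanD].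
Qed.

(** Clearing the other coordinates of [v] leaves [e_i0] up to sign. *)
Lemma zspan_complete B i0 v : (forall i, i != i0 -> zspan B (delta_mx 0 i)) ->
  zspan B v -> v 0 i0 ^+ 2 = 1 -> forall i, zspan B (delta_mx 0 i).
Proof.
move=> Bi Bv vi i; have [->|] := eqVneq i i0; last exact: Bi.
have -> : delta_mx 0 i0 =
    v 0 i0 *: (v - \sum_(j | j != i0) v 0 j *: delta_mx 0 j).
  rewrite {2}(row_sum_delta v) (bigD1 i0) //= addrK scalerA -expr2 vi.
  by rewrite scale1r.
apply/zspanZ/zspanB => //; apply: zspan_sum => j ji.
exact/zspanZ/Bi.
Qed.

(** If the rows of [B] generate, then [C *m B = 1] for some integer matrix [C];
    square matrices over a commutative ring have two-sided inverses, so
    [B *m C = 1], which is the uniqueness of coordinates. *)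
Lemma contains_Zbasis_mx (S : set 'rV[R]_n) (B : 'M[int]_n) :
  (forall i, zspan B (delta_mx 0 i)) ->
  (forall i, S (map_mx intr (row i B))) -> contains_Zbasis S.
Proof.
move=> eB BS.
have /choice[C CE] : forall i, exists c : 'rV[int]_n, c *m B = delta_mx 0 i.
  by move=> i; have [c _ cE] := eB i; exists c.
exists (fun i => map_mx intr (row i B)); split => //.
have CB : (\matrix_i C i) *m B = 1%:M.
  apply/row_matrixP => i; rewrite row_mul rowK row1.
  exact: CE.
have sumE (c : 'rV[int]_n) :
    \sum_i map_mx intr (row i B) *~ c 0 i = map_mx intr (c *m B) :> 'rV[R]_n.
  rewrite mulmx_sum_row raddf_sum; apply: eq_bigr => i _.
  by rewrite -scaler_int -map_mxZ.
split=> [i|_ [z _ <-]]; first by exists (row i B).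
have mapI : injective (map_mx intr : 'rV[int]_n -> 'rV[R]_n).
  move=> u v /rowP uv; apply/rowP => i; have := uv i; rewrite !mxE.
  by move/intr_inj.
exists (z *m (\matrix_i C i)); split; first by rewrite sumE -mulmxA CB mulmx1.
move=> d; rewrite sumE => /mapI ->.
by rewrite -mulmxA (mulmx1C CB) mulmx1.
Qed.

End IntegerBases.

(** * Lattice points of SSB(n, k) *)

Section SSBProof.
Local Open Scope ring_scope.
Local Open Scope classical_set_scope.
Variables (R : realType) (m k : nat).
Hypotheses (m_gt0 : (0 < m)%N) (k_le : (k <= m)%N).
Local Notation P := (SSB R m.+1 k).
Local Notation e i := (delta_mx 0 i : 'rV[int]_m.+1).
Local Notation "z %:V" := (map_mx intr z : 'rV[R]_m.+1) (at level 2).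

Definition slant (V : pzRingType) (x : 'rV[V]_m.+1) : V :=
  \sum_i (if i == ord0 then k%:R else 1) * x 0 i.

(** The inequalities [facet_form h x <= 1] cut out SSB(n, k): [inl true] is
    [x_0 <= 1], [inl false] is the slanted one and [inr i] is [x_i >= -1].  The
    forms are defined over any ring so that integer points can be tested
    over the integers. *)
Definition facet_form (V : pzRingType) (h : bool + 'I_m.+1)
    (x : 'rV[V]_m.+1) : V :=
  match h with
  | inl true => x 0 ord0
  | inl false => slant x
  | inr i => - x 0 i
  end.

Definition facet_normal (h : bool + 'I_m.+1) : 'rV[R]_m.+1 :=
  match h with
  | inl true => delta_mx 0 ord0
  | inl false => \row_i (if i == ord0 then k%:R else 1)
  | inr i => - delta_mx 0 i
  end.

Lemma dotv_normal h x : dotv (facet_normal h) x = facet_form h x.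
Proof.
have dotve (i : 'I_m.+1) (c : R) :
    \sum_j c * (delta_mx 0 i : 'rV[R]_m.+1) 0 j * x 0 j = c * x 0 i.
  rewrite (bigD1 i) //= !mxE !eqxx mulr1 big1 ?addr0 // => j ji.
  by rewrite !mxE (negPf ji) andbF mulr0 mul0r.
case: h => [[]|i] /=; rewrite /dotv.
- by rewrite -[RHS]mul1r -dotve; apply: eq_bigr => j _; rewrite mul1r.
- by apply: eq_bigr => j _; rewrite mxE.
- by rewrite -mulN1r -dotve; apply: eq_bigr => j _; rewrite !mxE mulN1r.
Qed.

Lemma dotv_int h z : dotv (facet_normal h) z%:V = (facet_form h z)%:~R.
Proof.
rewrite dotv_normal; case: h => [[]|i] /=; rewrite ?mxE ?rmorphN //.
rewrite /slant raddf_sum; apply: eq_bigr => i _ /=.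
by rewrite mxE rmorphM; case: ifP; rewrite ?rmorph_nat.
Qed.

Lemma SSBE x : P x <-> forall h, dotv (facet_normal h) x <= 1.
Proof.
have slantE : slant x = \sum_(i < m.+1 | i == 0%N :> nat) k%:R * x 0 i
    + \sum_(i < m.+1 | i != 0%N :> nat) x 0 i.
  rewrite (big_pred1 ord0) /slant; last by [].
  rewrite (bigD1 ord0) //=; congr (_ + _).
  by apply: eq_bigr => i /negPf ->; rewrite mul1r.
split=> [[x1 x2 x3] h|xh].
  rewrite dotv_normal; case: h => [[]|i] /=; first exact: x2.
  - by rewrite slantE.
  - by rewrite lerNl.
split=> [i|i i0|].
- by have := xh (inr i); rewrite dotv_normal /= lerNl.
- have -> : i = ord0 by apply: val_inj.
  by have := xh (inl true); rewrite dotv_normal.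
- by rewrite -slantE; have := xh (inl false); rewrite dotv_normal.
Qed.

Lemma slantD (V : pzRingType) (u v : 'rV[V]_m.+1) :
  slant (u + v) = slant u + slant v.
Proof.
by rewrite /slant -big_split; apply: eq_bigr => i _; rewrite mxE mulrDr.
Qed.

Lemma slantZ (V : comPzRingType) c (u : 'rV[V]_m.+1) :
  slant (c *: u) = c * slant u.
Proof.
by rewrite /slant mulr_sumr; apply: eq_bigr => i _; rewrite mxE mulrCA.
Qed.

Lemma slantN (V : comPzRingType) (u : 'rV[V]_m.+1) : slant (- u) = - slant u.
Proof. by rewrite -scaleN1r slantZ mulN1r. Qed.

Lemma slante i : i != ord0 -> slant (e i) = 1.
Proof.
move=> i0; rewrite /slant (bigD1 i) //= (negPf i0) !mxE !eqxx mulr1.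
by rewrite big1 ?addr0 // => j ji; rewrite !mxE (negPf ji) andbF mulr0.
Qed.

(** The bounds are two-sided because the opposite point must satisfy the
    inequalities too. *)
Lemma Ewald_int (z : 'rV[int]_m.+1) : (forall i, -1 <= z 0 i <= 1) ->
  -1 <= slant z <= 1 -> Ewald_points P z%:V.
Proof.
move=> zi zs.
have SSBz (y : 'rV[int]_m.+1) : (forall i, -1 <= y 0 i <= 1) ->
    -1 <= slant y <= 1 -> P y%:V.
  move=> yi ys; apply/SSBE => h; rewrite dotv_int lerz1.
  case: h => [[]|i] /=; first by case/andP: (yi ord0).
    by case/andP: ys.
  by have := yi i; rewrite lerNl => /andP[].
split; first by split; [exists z|exact: SSBz].
exists (- z)%:V; last by rewrite map_mxN opprK.
apply: SSBz => [i|]; rewrite ?slantN; first by rewrite mxE lerN2 lerNl andbC.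
by rewrite lerN2 lerNl andbC.
Qed.

(** Here [k <= m] is what makes room for [k] coordinates equal to [-1]. *)
Definition wpt : 'rV[int]_m.+1 :=
  \row_i (if i == ord0 then 1 else if (i <= k)%N then -1 else 0).

Lemma wpt0 : wpt 0 ord0 = 1.
Proof. by rewrite mxE eqxx. Qed.

Lemma slant_wpt : slant wpt = 0.
Proof.
rewrite /slant big_ord_recl wpt0 eqxx mulr1.
have -> : \sum_(i < m) (if lift ord0 i == ord0 then k%:R else 1) *
    wpt 0 (lift ord0 i) = - \sum_(i < m | (i < k)%N) 1.
  rewrite -sumrN [RHS]big_mkcond; apply: eq_bigr => i _.
  by rewrite !mxE /= mul1r /bump add1n.
by rewrite -(big_ord_widen _ (fun=> 1)) // sumr_const card_ord subrr.
Qed.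

Lemma Ewald_wpt i (t : int) : i != ord0 -> -1 <= t <= 1 ->
  -1 <= wpt 0 i + t <= 1 -> Ewald_points P (wpt + t *: e i)%:V.
Proof.
move=> i0 t1 wt; apply: Ewald_int => [j|].
  move: wt; rewrite !mxE /=; have [->|ji] := eqVneq j i; first by rewrite mulr1.
  by move=> _; rewrite mulr0 addr0; case: ifP => // _; case: ifP.
by rewrite slantD slantZ slant_wpt slante // add0r mulr1.
Qed.

Lemma Ewald_N (z : 'rV[int]_m.+1) :
  Ewald_points P z%:V -> Ewald_points P (- z)%:V.
Proof.
rewrite map_mxN => -[[[y _ <-] Pz] [u Pu uz]]; split.
  by split; [exists (- y) => //; rewrite map_mxN|rewrite -uz opprK].
by exists (map_mx intr y).
Qed.

Lemma Ewald_e i : i != ord0 -> Ewald_points P (e i)%:V.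
Proof.
move=> i0; apply: Ewald_int => [j|]; last by rewrite slante.
by rewrite mxE /=; case: (j == i).
Qed.

Lemma Ewald_eB i j : i != ord0 -> j != ord0 -> Ewald_points P (e i - e j)%:V.
Proof.
move=> i0 j0; apply: Ewald_int => [l|].
  by rewrite !mxE /=; case: (l == i); case: (l == j).
by rewrite slantD slantN !slante // subrr.
Qed.

Lemma wpt_entry i : i != ord0 -> wpt 0 i = if (i <= k)%N then -1 else 0.
Proof. by move=> i0; rewrite mxE (negPf i0). Qed.

(** The sign for which the [i]-th coordinate of [wpt + wdir i *: e i] is [0] or
    [-1]. *)
Definition wdir (i : 'I_m.+1) : int := if (i <= k)%N then 1 else -1.

Definition cap_basis : 'M[int]_m.+1 :=
  \matrix_i (if i == ord0 then wpt else wpt + wdir i *: e i).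

Lemma cap_basis_span i : zspan cap_basis (e i).
Proof.
have wB : zspan cap_basis wpt.
  by have := zspan_row cap_basis ord0; rewrite rowK eqxx.
apply: (@zspan_complete _ _ ord0 wpt) => // [{}i i0|]; last by rewrite wpt0.
have := zspan_row cap_basis i; rewrite rowK (negPf i0) => /zspanB/(_ wB).
rewrite addrAC subrr add0r => /(zspanZ (wdir i)).
by rewrite scalerA /wdir; case: ifP => _; rewrite ?mulrNN mulr1 scale1r.
Qed.

Lemma nonzero_index : exists i : 'I_m.+1, i != ord0.
Proof. by exists ord_max; rewrite -val_eqE /= -lt0n. Qed.

Lemma cap_basis_row i :
  Ewald_points P (row i cap_basis)%:V /\ row i cap_basis 0 ord0 = 1.
Proof.
rewrite rowK; case: ifP => [_|/negbT i0].
  have [i1 i10] := nonzero_index.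
  split; last exact: wpt0.
  have := @Ewald_wpt i1 0 i10 isT; rewrite scale0r !addr0; apply.
  by rewrite wpt_entry //; case: ifP.
split; last by rewrite mxE wpt0 !mxE /= eq_sym (negPf i0) mulr0 addr0.
by apply: Ewald_wpt => //; rewrite /wdir ?wpt_entry //; case: ifP.
Qed.

Lemma tight_form h x : tight facet_normal h x -> facet_form h x = 1.
Proof. by rewrite -dotv_normal. Qed.

Lemma tight_int h (z : 'rV[int]_m.+1) :
  tight facet_normal h z%:V <-> facet_form h z = 1.
Proof.
rewrite /tight /= dotv_int; split => [|->] //.
by rewrite -[RHS]/(1%:~R) => /intr_inj.
Qed.

Lemma SSB_facet_basis h :
  contains_Zbasis (Ewald_points P `&` tight facet_normal h).
Proof.
have [i1 i10] := nonzero_index.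
case: h => [[]|i].
- apply: contains_Zbasis_mx cap_basis_span _ => j.
  have [Ej j1] := cap_basis_row j; split => //; exact/tight_int.
- pose B := \matrix_i (if i == ord0 then wpt + e i1 else e i).
  apply: (@contains_Zbasis_mx _ _ _ B) => [j|j].
    apply: (@zspan_complete _ _ ord0 (wpt + e i1)) => [{}j j0||].
    + by have := zspan_row B j; rewrite rowK (negPf j0).
    + by have := zspan_row B ord0; rewrite rowK eqxx.
    + by rewrite mxE wpt0 mxE /= eq_sym (negPf i10) addr0.
  rewrite rowK; case: ifP => [_|/negbT j0].
    split.
      rewrite -[e i1]scale1r; apply: Ewald_wpt => //.
      by rewrite wpt_entry //; case: ifP.
    by apply/tight_int; rewrite /= slantD slant_wpt slante.
  by split; [exact: Ewald_e|apply/tight_int; rewrite /= slante].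
have [->|i0] := eqVneq i ord0.
  apply: (@contains_Zbasis_mx _ _ _ (- cap_basis)) => [j|j].
    have [c _ cE] := cap_basis_span j; exists (- c) => //.
    by rewrite mulNmx mulmxN opprK.
  have [Ej j1] := cap_basis_row j; rewrite raddfN /=.
  split; first exact: Ewald_N.
  by apply/tight_int => /=; rewrite mxE opprK.
(* The scalar is chosen so that [v] has [i]-th coordinate [-1]. *)
pose v := wpt + (if (i <= k)%N then 0 else -1) *: e i.
pose B := \matrix_j
  (if j == ord0 then v else if j == i then - e i else e j - e i).
apply: (@contains_Zbasis_mx _ _ _ B) => [j|j].
  have iB : zspan B (e i).
    have := zspan_row B i; rewrite rowK (negPf i0) eqxx => /zspanN.
    by rewrite opprK.
  apply: (@zspan_complete _ _ ord0 v) => [{}j j0||].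
  + have [->//|ji] := eqVneq j i.
    have := zspan_row B j; rewrite rowK (negPf j0) (negPf ji) => /zspanD/(_ iB).
    by rewrite subrK.
  + by have := zspan_row B ord0; rewrite rowK eqxx.
  + by rewrite mxE wpt0 !mxE /= eq_sym (negPf i0) mulr0 addr0.
rewrite rowK; case: ifP => [_|/negbT j0]; first split.
- by apply: Ewald_wpt => //; rewrite ?wpt_entry //; case: ifP.
- by apply/tight_int; rewrite /= mxE wpt_entry // !mxE !eqxx mulr1; case: ifP.
case: ifP => [_|/negbT ji].
  split; first by apply: Ewald_N; exact: Ewald_e.
  by apply/tight_int; rewrite /= !mxE !eqxx.
split; first exact: Ewald_eB.
by apply/tight_int; rewrite /= !mxE !eqxx eq_sym (negPf ji).
Qed.

Lemma SSB_star_point (J : set (bool + 'I_m.+1)) x : J !=set0 -> P x ->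
  (forall h, J h -> tight facet_normal h x) ->
  exists l h, [/\ Ewald_points P l, J h, tight facet_normal h l,
    forall h', J h' -> tight facet_normal h' l -> h' = h &
    forall h', J h' -> ~ tight facet_normal h' (- l)].
Proof.
move=> [hJ JhJ] Px Jx.
suff [z [h [Ez Jh zh zuniq zN]]] : exists z h, [/\ Ewald_points P z%:V, J h,
    facet_form h z = 1, forall h', J h' -> facet_form h' z = 1 -> h' = h &
    forall h', J h' -> facet_form h' (- z) <> 1].
  exists z%:V, h; split => //; first exact/tight_int.
    by move=> h' Jh' /tight_int; exact: zuniq.
  by move=> h' Jh'; rewrite -map_mxN => /tight_int; exact: zN.
have [JD|nJD] := pselect (J (inl false)).
  (* All coordinates equal to [-1] is incompatible with the slanted facet. *)
  have [j j0 nJj] : exists2 j, j != ord0 & ~ J (inr j).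
    apply: contrapT => nj.
    have xj j : j != ord0 -> x 0 j = -1.
      move=> j0; have /Jx/tight_form /= <- : J (inr j).
        by apply: contrapT => nJ; apply: nj; exists j.
      by rewrite opprK.
    have := tight_form (Jx _ JD).
    rewrite /= /slant (bigD1 ord0) //= (eq_bigr (fun=> -1)); last first.
      by move=> i i0; rewrite (negPf i0) mul1r xj.
    rewrite sumr_const cardC1 card_ord /= => sl.
    have := (SSBE x).1 Px (inl true); rewrite dotv_normal /= => x01.
    have : k%:R * x 0 ord0 <= m%:R :> R.
      apply: le_trans (_ : k%:R * 1 <= _); first by rewrite ler_wpM2l.
      by rewrite mulr1 ler_nat.
    by move: sl; rewrite mulNrn; lra.
  exists (e j), (inl false); split => //.
  - exact: Ewald_e.
  - by rewrite /= slante.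
  - case=> [[]|i] //= Ji; rewrite mxE /=.
      by rewrite eq_sym (negPf j0).
    by case: eqP.
  case=> [[]|i] //= Ji; rewrite ?mxE ?mxE /=.
  - by rewrite eq_sym (negPf j0).
  - by rewrite slantN slante.
  - rewrite opprK; case: eqP => // ij; by rewrite ij in Ji.
have [[i i0 Ji]|nJi] := pselect (exists2 i, i != ord0 & J (inr i)).
  exists (- e i), (inr i); split => //.
  - by apply: Ewald_N; exact: Ewald_e.
  - by rewrite /= !mxE !eqxx.
  - case=> [[]|i'] //= Ji'; rewrite !mxE /=.
      by case: eqP.
    by rewrite opprK; case: eqP => // ->.
  case=> [[]|i'] //= Ji'; rewrite opprK mxE /=.
    by rewrite eq_sym (negPf i0).
  by case: eqP.
have Jside h : J h -> h = inl true \/ h = inr ord0.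
  case: h => [[]|i] Jh; [by left|by []|right].
  by have [->//|i0] := eqVneq i ord0; case: nJi; exists i.
have Ew : Ewald_points P wpt%:V.
  by have [] := cap_basis_row ord0; rewrite rowK eqxx.
have nboth : J (inl true) -> J (inr ord0) -> False.
  by move=> /Jx/tight_form /= + /Jx/tight_form /=; lra.
have [hE|hE] := Jside _ JhJ; rewrite hE in JhJ.
  exists wpt, (inl true); split => //; first exact: wpt0.
    by move=> h' Jh' _; have [//|h'E] := Jside _ Jh'; case: nboth; rewrite -?h'E.
  move=> h' Jh'; have [->|h'E] := Jside _ Jh'; first by rewrite /= mxE wpt0.
  by case: nboth; rewrite -?h'E.
exists (- wpt), (inr ord0); split => //; first exact: Ewald_N.
- by rewrite /= mxE wpt0 opprK.
- by move=> h' Jh' _; have [h'E|//] := Jside _ Jh'; case: nboth; rewrite -?h'E.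
move=> h' Jh'; have [h'E|->] := Jside _ Jh'; first by case: nboth; rewrite -?h'E.
by rewrite /= opprK wpt0.
Qed.

End SSBProof.

Theorem proposition5p16 (R : realType) (n k : nat)
  (hn : (2 <= n)%N) (hk : (k <= n - 1)%N) :
  weak_Ewald (SSB R n k) /\ strong_Ewald (SSB R n k) /\ star_Ewald (SSB R n k).
Proof.
case: n hn hk => // m m_gt0; rewrite subn1 => k_le.
have PE := @SSBE R m k; have ZB := SSB_facet_basis R m_gt0 k_le.
split; first exact: weak_Ewald_tight (inl true) ZB.
split; first exact: strong_Ewald_tight PE (inl true) isT ZB.
apply: star_Ewald_tight PE (inl true) isT ZB _ => J x.
exact: SSB_star_point m_gt0 k_le J x.
Qed.
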